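(* Let $p$ be a nonconstant polynomial hyperbolic in direction $e$, let $p'_e(x):=Dp(x)[e]$, and let $\Lambda'_{++,e}$ be the hyperbolicity cone of $p'_e$. Then the function $q_e:\Lambda'_{++,e}\to\mathbb{R}$, $q_e(x):=p(x)/p'_e(x)$, is concave.
   Context: $\mathcal{E}$ is a finite-dimensional Euclidean space. A homogeneous polynomial $p:\mathcal{E}\to\mathbb{R}$ is hyperbolic in direction $e\in\mathcal{E}$ if $p(e)>0$ and for every $x\in\mathcal{E}$ the univariate polynomial $t\mapsto p(x+te)$ has only real roots. Then $p'_e$ is also hyperbolic in direction $e$, and $\Lambda'_{++,e}$ is the connected component of $\{x:p'_e(x)>0\}$ containing $e$ (a convex set; if $p$ is linear, $p'_e$ is a positive constant and $\Lambda'_{++,e}=\mathcal{E}$). In particular $p'_e>0$ on $\Lambda'_{++,e}$. The closed hyperbolicity cone of $p$ is not assumed to be regular. *)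

(* Defs.v *)
From HB Require Import structures.
From mathcomp Require Import all_boot all_order all_algebra.
From mathcomp Require Import all_classical all_reals all_analysis.
From mathcomp Require Import complex.
(* The notations of mpoly, left out here, clash with those of
   mathcomp-analysis. *)
From mathcomp Require Import -(notations) mpoly.

Set Implicit Arguments.
Unset Strict Implicit.
Unset Printing Implicit Defensive.

Import Order.TTheory GRing.Theory Num.Theory.
Import numFieldNormedType.Exports.

Local Open Scope classical_set_scope.
Local Open Scope ring_scope.
Local Open Scope convex_scope.

(* Vector provides finite dimension, NormedModule the norm and its topology. *)
HB.mixin Record NormedVector_isEuclidean (R : realType) E
    of NormedModule R E & Vector R E := {
  dotp : {dot E for (@idfun R)} ;
  sqr_norm_dotp : forall x : E, `|x| ^+ 2 = dotp x x
}.

#[short(type="euclideanType")]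
HB.structure Definition Euclidean (R : realType) :=
  { E of NormedModule R E & Vector R E & NormedVector_isEuclidean R E }.

(* The library's convex_function does not require D to be convex; here it is. *)
Definition concave_function (R : numFieldType) (E : lmodType R)
    (E' := convex_lmodType E) (D : set E') (f : E' -> R^o) : Prop :=
  convex_set D /\
  forall t : {i01 R},
    {in D &, forall x y : E', f x <| t |> f y <= f (x <| t |> y)}.

Section Hyperbolic.
Context {R : realType} {E : euclideanType R}.
Implicit Types (p : E -> R) (e x : E).

(* Polynomials on E are polynomials in linear coordinates; homogeneity and its
   degree do not depend on the basis, so vbasis is as good as any other. *)
Definition homogeneous_polynomial p : Prop :=
  exists (d : nat) (P : mpoly (\dim {: E}) R),
    P \is ishomog1 d mdeg /\
    forall x, p x = meval (fun i => coord (vbasis {: E}) i x) P.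

Definition real_rooted (q : {poly R}) : Prop :=
  forall z : R[i], root (map_poly (real_complex R) q) z -> complex.Im z = 0.

(* For polynomial p, the q below exists and is unique, R being infinite. *)
Definition hyperbolic p e : Prop :=
  [/\ homogeneous_polynomial p, 0 < p e &
    forall x, exists q : {poly R},
      (forall t : R, q.[t] = p (x + t *: e)) /\ real_rooted q].

Definition dir_deriv p e : E -> R := fun x => 'd p x e.

Definition hyp_cone p e : set E := connected_component [set x | 0 < p x] e.

End Hyperbolic.

(* Main.v *)
(* Let [F (x, s) = p x - s * p'_e x], where [p'_e] is the derivative of [p] along
   [e]. On a line parallel to [e], [p] restricts to a real-rooted polynomial [q]
   and [F] to [q - s q'], which is again real-rooted: [F] is hyperbolic in
   direction [(e, 0)]. A pair [(x, s)] lies in the hyperbolicity cone of [F] iff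
   [q - s q'] has no root in [0, +oo[, and this happens iff [q' > 0] on [0, +oo[
   and [s < q 0 / q' 0]. So that cone is the strict hypograph of [p / p'_e] over
   the cone of [p'_e], and both the convexity of the latter and the concavity of
   [p / p'_e] follow from Garding's theorem that hyperbolicity cones are convex.

   Garding's theorem is proved by following complex roots: if [a], [b] are in the
   cone of [P], then for [Im t > 0] and [Im s >= 0] all the roots [z] of
   [P (t e + s b + z a)] have a negative imaginary part, since one can deform [s b]
   to [0] without any root crossing the real axis. In particular
   [P (i t e + i b + i a) != 0] for real [t > 0], hence [P (a + b + t e) != 0]. *)

Require Import Defs.
From HB Require Import structures.
From mathcomp Require Import all_boot all_order all_algebra.
From mathcomp Require Import all_classical all_reals all_analysis.
From mathcomp Require Import complex ring lra zify.
From mathcomp Require Import -(notations) mpoly.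

Set Implicit Arguments.
Unset Strict Implicit.
Unset Printing Implicit Defensive.

Import Order.TTheory GRing.Theory Num.Theory.
Import numFieldNormedType.Exports.

Local Open Scope classical_set_scope.
Local Open Scope ring_scope.

Local Notation homog d P := (P \is ishomog1 d mdeg).

(** * Multivariate polynomials *)

Lemma size_poly_coef_neq0 (A : nzSemiRingType) (q : {poly A}) m :
  (size q <= m.+1)%N -> q`_m != 0 -> size q = m.+1.
Proof.
move=> sq qm; apply/eqP; rewrite eqn_leq sq ltnNge.
by apply: contra qm => /(nth_default 0) ->.
Qed.

Lemma horner_inj (R : numDomainType) (q1 q2 : {poly R}) :
  (forall t, q1.[t] = q2.[t]) -> q1 = q2.
Proof.
move=> q12; apply/eqP; rewrite -subr_eq0; apply/eqP.
apply: (@roots_geq_poly_eq0 _ _ [seq i%:R | i <- iota 0 (size (q1 - q2))]).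
- by apply/allP => t _; rewrite /root !hornerE q12 subrr.
- by rewrite map_inj_uniq ?iota_uniq //; exact: mulrIn.
- by rewrite size_map size_iota.
Qed.

Section MultivariateEvaluation.
Context {n : nat} {A : comNzRingType}.
Implicit Types P : mpoly n A.

Lemma rmorph_mmap (S T : comNzRingType) (f : {rmorphism A -> S})
    (g : {rmorphism S -> T}) (v : 'I_n -> S) P :
  g (mmap f v P) = mmap (g \o f) (g \o v) P.
Proof.
rewrite /mmap rmorph_sum; apply: eq_bigr => m _.
rewrite rmorphM /mmap1 rmorph_prod; congr (_ * _).
by apply: eq_bigr => i _; rewrite rmorphXn.
Qed.

Lemma eq_mmap (S : nzRingType) (f g : A -> S) (v w : 'I_n -> S) P :
  f =1 g -> v =1 w -> mmap f v P = mmap g w P.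
Proof.
move=> fg vw; apply: eq_bigr => m _; rewrite fg; congr (_ * _).
exact: mmap1_eq.
Qed.

Lemma mmap_homogZ (S : comNzRingType) (f : A -> S) d (c : S) (v : 'I_n -> S) P :
  homog d P -> mmap f (fun i => c * v i) P = c ^+ d * mmap f v P.
Proof.
move=> /dhomogP hP; rewrite /mmap mulr_sumr [LHS]big_seq [RHS]big_seq.
apply: eq_bigr => m /hP /= <-; rewrite mulrCA; congr (_ * _).
rewrite /mmap1 mdegE -prodrXr -big_split /=.
by apply: eq_bigr => i _; rewrite exprMn.
Qed.

(** Each factor [v i + w i X] of a monomial contributes [w i] to the top coefficient, so on a line
    the coefficient of degree [d] depends only on the direction. The families of polynomials studied
    below thus have a constant leading coefficient. *)
Lemma size_coef_mmap_line (S : comNzRingType) (f : A -> S) d (v w : 'I_n -> S) P :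
  homog d P ->
  let q := mmap (polyC \o f) (fun i => (v i)%:P + (w i)%:P * 'X) P in
  (size q <= d.+1)%N /\ q`_d = mmap f w P.
Proof.
move=> /dhomogP hP /=.
have line_le i k : (size (((v i)%:P + (w i)%:P * 'X) ^+ k)%R <= k.+1)%N /\
    (((v i)%:P + (w i)%:P * 'X) ^+ k)`_k = w i ^+ k.
  elim: k => [|k [IHs IHc]]; first by rewrite !expr0 size_poly1 coef1.
  set q := _ ^+ k in IHs IHc *; rewrite exprS -/q; split.
    rewrite (leq_trans (size_polyMleq _ _)) // addnC.
    have : (size ((v i)%:P + (w i)%:P * 'X)%R <= 2)%N.
      rewrite (leq_trans (size_polyD _ _)) // geq_max (leq_trans (size_polyC_leq1 _)) //=.
      rewrite (leq_trans (size_polyMleq _ _)) // size_polyX addn2 /= ltnS.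
      exact: size_polyC_leq1.
    by move: IHs; case: (size q) => [|?]; lia.
  rewrite mulrDl coefD mulrAC coefMX /= !coefCM IHc exprS.
  by rewrite (nth_default _ IHs) mulr0 add0r.
have prod_le (m : multinom n) : (size (mmap1 (fun i => (v i)%:P + (w i)%:P * 'X) m)%R
      <= (mdeg m).+1)%N /\
    (mmap1 (fun i => (v i)%:P + (w i)%:P * 'X) m)`_(mdeg m) = mmap1 w m.
  rewrite /mmap1 mdegE.
  elim/big_rec3: _ => [|i y p N _ [IHs IHc]]; first by rewrite size_poly1 coef1.
  have [Ls Lc] := line_le i (m i).
  set q := _ ^+ _ in Ls Lc *; split.
    rewrite (leq_trans (size_polyMleq _ _)) //.
    by move: Ls IHs; case: (size q) => [|?]; lia.
  rewrite coefM (bigD1 (inord (m i) : 'I_(m i + N).+1)) //= inordK ?ltnS ?leq_addr //.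
  rewrite Lc addKn IHc big1 ?addr0 // => j jm.
  have [mj|jm'] := ltnP (m i) j.
    by rewrite (nth_default _ (leq_trans Ls mj)) mul0r.
  have {}jm : (j < m i)%N.
    rewrite ltn_neqAle jm' andbT; apply: contra jm => /eqP jm.
    by apply/eqP/val_inj; rewrite /= inordK ?ltnS ?leq_addr.
  by rewrite [X in _ * X]nth_default ?mulr0 // (leq_trans IHs) //; lia.
split.
  rewrite /mmap big_seq; apply: (leq_trans (size_sum _ _ _)).
  apply/bigmax_leqP_seq => m _ mP /=; rewrite mul_polyC.
  rewrite (leq_trans (size_scale_leq _ _)) //.
  by rewrite -(hP _ mP); case: (prod_le m).
rewrite /mmap coef_sum [LHS]big_seq [RHS]big_seq.
apply: eq_bigr => m mP /=; rewrite coefCM; congr (_ * _).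
by rewrite -(hP _ mP); case: (prod_le m).
Qed.

Lemma mpoly_ring_ind (Q : mpoly n A -> Prop) :
  (forall c, Q (mpolyC n c)) -> (forall i, Q (mpolyX A (mnm1 i))) ->
  (forall P1 P2, Q P1 -> Q P2 -> Q (P1 + P2)) ->
  (forall P1 P2, Q P1 -> Q P2 -> Q (P1 * P2)) ->
  forall P, Q P.
Proof.
move=> QC QX Qadd Qmul P; elim/mpolyind: P => [|c m P _ _ IH]; first exact: (QC 0).
apply: (Qadd) IH; rewrite -mul_mpolyC; apply: (Qmul) => //.
rewrite mpolyXE_id; apply: (big_ind Q) => [| |i _]; [exact: (QC 1)|exact: Qmul|].
by elim: (m i) => [|k IHk]; [exact: (QC 1)|rewrite exprS; apply: (Qmul)].
Qed.

(** Chain rule: both sides obey the Leibniz rule in [P], so it suffices to compare them on constants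
    and variables. *)
Lemma deriv_mmap (S : comNzRingType) (f : {rmorphism A -> S})
    (w : 'I_n -> {poly S}) P :
  (mmap (polyC \o f) w P)^`() =
  \sum_i (w i)^`() * mmap (polyC \o f) w (mderiv i P).
Proof.
pose g : {rmorphism A -> {poly S}} := GRing.RMorphism.clone _ _ (polyC \o f) _.
rewrite -/(mmap g w P).
under eq_bigr do rewrite -/(mmap g w _).
elim/mpoly_ring_ind: P => [c|i|P1 P2 IH1 IH2|P1 P2 IH1 IH2].
- rewrite mmapC /= derivC big1 // => i _.
  by rewrite mderivC rmorph0 mulr0.
- rewrite mmapX mmap1U (bigD1 i) //= mderivX mnm1E eqxx scale1r.
  have -> : mnm_sub (mnm1 i) (mnm1 i) = mnm0 by apply/mnmP => j; rewrite mnmBE subnn mnm0E.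
  rewrite mpolyX0 rmorph1 mulr1 big1 ?addr0 // => j ji.
  by rewrite mderivX mnm1E eq_sym (negPf ji) scale0r rmorph0 mulr0.
- rewrite rmorphD derivD IH1 IH2 -big_split /=.
  by apply: eq_bigr => i _; rewrite mderivD rmorphD mulrDr.
- rewrite rmorphM derivM IH1 IH2 mulr_suml mulr_sumr -big_split /=.
  by apply: eq_bigr => i _; rewrite mderivM rmorphD !rmorphM /=; ring.
Qed.

Lemma mderiv_homog d i P : homog d P -> homog d.-1 (mderiv i P).
Proof.
move=> /dhomogP hP; apply/dhomogP => m; rewrite mcoeff_msupp mcoeff_mderiv => mP.
have /hP <- : mnm_add m (mnm1 i) \in msupp P.
  by rewrite mcoeff_msupp; apply: contraNneq mP => ->; rewrite mul0rn.
by rewrite /= mdegD mdeg1 addn1.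
Qed.

Lemma mwiden_homog d P : homog d P -> homog d (mwiden P).
Proof.
move=> /dhomogP hP; rewrite (mpolyE P) rmorph_sum [X in X \is _]big_seq /=.
apply: rpred_sum => m mP; rewrite mwidenZ mwidenX; apply: rpredZ.
rewrite dhomogX /= -(hP _ mP) !mdegE big_ord_recr /= mnmwiden_ordmax addn0.
by apply/eqP; rewrite mdegE; apply: eq_bigr => i _; rewrite mnmwiden_widen.
Qed.

Lemma mmap_mwiden (S : comNzRingType) (f : {rmorphism A -> S})
    (v : 'I_n.+1 -> S) P :
  mmap f v (mwiden P) = mmap f (fun i => v (widen_ord (leqnSn n) i)) P.
Proof.
rewrite /mwiden rmorph_mmap; apply: eq_mmap => [c|i] /=.
  exact: mmapC.
by rewrite mmapX mmap1U.
Qed.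

Definition mdirderiv (e : 'I_n -> A) P : mpoly n A := \sum_i e i *: mderiv i P.

Lemma mdirderiv_homog d e P : homog d P -> homog d.-1 (mdirderiv e P).
Proof. by move=> hP; apply: rpred_sum => i _; apply/rpredZ/mderiv_homog. Qed.

Definition mline (v w : 'I_n -> A) P : {poly A} :=
  mmap (polyC \o idfun) (fun i => (v i)%:P + (w i)%:P * 'X) P.

Lemma deriv_mline v e P : (mline v e P)^`() = mline v e (mdirderiv e P).
Proof.
rewrite /mline deriv_mmap.
pose g : {rmorphism A -> {poly A}} := GRing.RMorphism.clone _ _ (polyC \o idfun) _.
rewrite -/(mmap g _ (mdirderiv e P)) rmorph_sum; apply: eq_bigr => i _.
rewrite -mul_mpolyC rmorphM /= mmapC derivD derivC add0r derivM derivC derivX.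
by rewrite mul0r add0r mulr1.
Qed.

Lemma horner_map_mline (S : comNzRingType) (f : {rmorphism A -> S}) v w P t :
  (map_poly f (mline v w P)).[t] = mmap f (fun i => f (v i) + t * f (w i)) P.
Proof.
pose g : {rmorphism {poly A} -> S} :=
  GRing.RMorphism.clone _ _ (horner_eval t \o map_poly f) _.
pose h : {rmorphism A -> {poly A}} := GRing.RMorphism.clone _ _ (polyC \o idfun) _.
rewrite -[LHS]/(g (mmap h _ P)) rmorph_mmap; apply: eq_mmap => [c|i] /=.
  by rewrite map_polyC /= /horner_eval hornerC.
rewrite rmorphD rmorphM /= map_polyX !map_polyC /= /horner_eval !hornerE.
by rewrite [t * _]mulrC.
Qed.

Lemma horner_mline v w P t : (mline v w P).[t] = mmap idfun (fun i => v i + t * w i) P.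
Proof. by rewrite -(horner_map_mline idfun) map_poly_id. Qed.

End MultivariateEvaluation.

(** * Complex roots of polynomial paths *)

(* A family of polynomials [slice h u], indexed by [u], is coded by a
   bivariate polynomial [h]. *)
Local Notation slice h u := (map_poly (horner_eval u) h).

Section PolynomialPaths.
Context {K : numFieldType}.
Implicit Types (h : {poly {poly K}}) (p : {poly K}).

Lemma poly_lipschitz p : exists2 L, 0 <= L & forall x y,
  `|x| <= 1 -> `|y| <= 1 -> `|p.[x] - p.[y]| <= L * `|x - y|.
Proof.
elim/poly_ind: p => [|p c [L L0 IH]].
  by exists 0 => // x y _ _; rewrite !horner0 subrr normr0 mul0r.
have [M leM] := poly_disk_bound p 1.
have M0 : 0 <= M by rewrite (le_trans (normr_ge0 p.[0])) // leM // normr0.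
exists (L + M) => [|x y x1 y1]; first exact: addr_ge0.
rewrite !hornerMXaddC.
have -> : p.[x] * x + c - (p.[y] * y + c) = (p.[x] - p.[y]) * x + p.[y] * (x - y).
  by ring.
rewrite (le_trans (ler_normD _ _)) // [leRHS]mulrDl !normrM lerD //.
  by rewrite -[leRHS]mulr1 ler_pM // IH.
by rewrite ler_wpM2r // leM.
Qed.

Lemma slice_lipschitz h b : exists2 L, 0 <= L & forall u v z,
  `|u| <= 1 -> `|v| <= 1 -> `|z| <= b ->
  `|(slice h u).[z] - (slice h v).[z]| <= L * `|u - v|.
Proof.
have [b0|b0] := boolP (0 <= b); last first.
  by exists 0 => // u v z _ _ /(le_trans (normr_ge0 _)); rewrite (negPf b0).
elim/poly_ind: h => [|h c [L L0 IH]].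
  by exists 0 => // u v z _ _ _; rewrite !rmorph0 !horner0 subrr normr0 mul0r.
have [M M0 leM] := poly_lipschitz c.
exists (L * b + M) => [|u v z u1 v1 zb]; first by rewrite addr_ge0 ?mulr_ge0.
rewrite !rmorphD !rmorphM /= !map_polyX !map_polyC /= !hornerMXaddC.
set x := _.[z]; set y := _.[z]; rewrite /horner_eval.
have -> : x * z + c.[u] - (y * z + c.[v]) = (x - y) * z + (c.[u] - c.[v]).
  by ring.
rewrite (le_trans (ler_normD _ _)) // [leRHS]mulrDl lerD ?leM // normrM.
by rewrite -mulrA [b * _]mulrC mulrA ler_pM // IH.
Qed.

(** Cauchy's bound: with [S] bounding the sum of the lower coefficients on the disk, a root with
    [1 < |z|] satisfies [|c| * |z| ^ d <= S * |z| ^ d.-1], so [|z| <= S / |c|]. *)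
Lemma slice_roots_bounded h d c : (size h <= d.+1)%N -> h`_d = c%:P -> c != 0 ->
  exists2 b, 0 <= b & forall u z, `|u| <= 1 -> root (slice h u) z -> `|z| <= b.
Proof.
move=> sh hd c0; have nc : 0 < `|c| by rewrite normr_gt0.
pose M i : K := sval (poly_disk_bound h`_i 1).
have leM i (u : K) : `|u| <= 1 -> `|(h`_i).[u]| <= M i := svalP (poly_disk_bound h`_i 1) u.
have M0 i : 0 <= M i.
  by rewrite (le_trans (normr_ge0 (h`_i).[0])) // leM // normr0.
pose S : K := \sum_(i < d) M i; have S0 : 0 <= S by apply: sumr_ge0.
have SM : 0 <= S / `|c| by rewrite divr_ge0.
exists (1 + S / `|c|) => [|u z u1]; first by rewrite addr_ge0.
rewrite /root (@horner_coef_wide _ d.+1); last first.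
  exact: leq_trans (size_poly _ _) sh.
rewrite big_ord_recr /=.
have -> : (slice h u)`_d = c by rewrite coef_map hd /= /horner_eval hornerC.
move/eqP.
have [z1 _|z1] := real_leP (normr_real z) (normr_real (1 : K)).
  by rewrite normr1 in z1; rewrite (le_trans z1) // lerDl.
rewrite normr1 in z1.
move=> /(canRL (addrK _)) /(congr1 Num.norm).
rewrite add0r normrN normrM normrX.
(* In degree 0 the slice is the constant [c], which has no root. *)
case: d @S S0 SM {sh hd} => [|d] S S0 SM.
  rewrite big_ord0 normr0 expr0 mulr1 => /esym/eqP.
  by rewrite normr_eq0 (negPf c0).
move=> eqz; have : `|c| * `|z| ^+ d.+1 <= S * `|z| ^+ d.
  rewrite -eqz (le_trans (ler_norm_sum _ _ _)) // mulr_suml.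
  apply: ler_sum => i _. rewrite normrM normrX coef_map /= ler_pM ?exprn_ge0 ?leM //.
  by rewrite ler_weXn2l ?ltW // -ltnS.
rewrite exprS mulrA -ler_pdivlMr ?exprn_gt0 ?(lt_trans ltr01) //.
rewrite mulfK; last by rewrite gt_eqF // exprn_gt0 // (lt_trans ltr01).
by rewrite mulrC -ler_pdivlMr // => /le_trans; apply; rewrite lerDr.
Qed.
End PolynomialPaths.

(** A root [z] of the slice at [u] makes the slice at [v] small at [z], while the latter is [c]
    times the product of the [z - z'] over its roots [z']. If all of these were at distance at least
    [eps], its norm would be at least [|c| * eps ^ d]. *)
Lemma slice_roots_continuous (K : numClosedFieldType) (h : {poly {poly K}}) d c eps :
  (size h <= d.+1)%N -> h`_d = c%:P -> c != 0 -> 0 < eps ->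
  exists2 del, 0 < del & forall u v z, `|u| <= 1 -> `|v| <= 1 -> `|u - v| < del ->
    root (slice h u) z -> exists2 z', root (slice h v) z' & `|z - z'| < eps.
Proof.
move=> sh hd c0 eps0; have nc : 0 < `|c| by rewrite normr_gt0.
have [b b0 leb] := slice_roots_bounded sh hd c0.
have [L L0 leL] := slice_lipschitz h b.
(* [L] itself may vanish, and a divisor is wanted. *)
have L1 : 0 < L + 1 by rewrite ltr_wpDl.
have ce0 : 0 < `|c| * eps ^+ d by rewrite mulr_gt0 ?exprn_gt0.
exists (`|c| * eps ^+ d / (L + 1)) => [|u v z u1 v1 uv uz]; first exact: divr_gt0.
have hvd : (slice h v)`_d = c by rewrite coef_map hd /= /horner_eval hornerC.
have shv : size (slice h v) = d.+1.
  by apply: size_poly_coef_neq0; rewrite ?hvd ?(leq_trans (size_poly _ _) sh).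
have [rs hv] := closed_field_poly_normal (slice h v).
have lc : lead_coef (slice h v) = c by rewrite lead_coefE shv.
have srs : size rs = d.
  by move: shv; rewrite {1}hv lc size_scale // size_prod_XsubC; case.
have [/hasP[z' z'rs zz']|/hasPn far] := boolP (has (fun z' => `|z - z'| < eps) rs).
  by exists z' => //; rewrite hv rootZ ?lc // root_prod_XsubC.
have : `|c| * eps ^+ d <= `|(slice h v).[z]|.
  rewrite hv lc hornerZ normrM ler_wpM2l // -srs.
  elim: rs far {hv srs} => [_|x rs IH far].
    by rewrite big_nil hornerC normr1 expr0.
  rewrite big_cons hornerM normrM exprS ler_pM ?exprn_ge0 ?(ltW eps0) //.
    rewrite hornerXsubC real_leNgt ?normr_real ?gtr0_real //.
    exact: far (mem_head _ _).
  by apply: IH => y yrs; apply: far; rewrite inE yrs orbT.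
have := leL u v z u1 v1 (leb _ _ u1 uz); rewrite (eqP uz) sub0r normrN.
move=> h1 /le_trans /(_ h1) h2; suff : L * `|u - v| < `|c| * eps ^+ d.
  by move=> /(le_lt_trans h2); rewrite ltxx.
rewrite (le_lt_trans (_ : _ <= (L + 1) * `|u - v|)) ?ler_wpM2r ?lerDl //.
by rewrite mulrC -ltr_pdivlMr.
Qed.

(** Connectedness of [[0, 1]]: the supremum of the set where [Q] holds lies in that set, and cannot
    be less than 1. *)
Lemma locally_constant_unit_interval (R : realType) (Q : R -> Prop) :
  (forall u, 0 <= u <= 1 -> exists2 del, 0 < del &
     forall v, 0 <= v <= 1 -> `|u - v| < del -> (Q u <-> Q v)) ->
  Q 0 -> Q 1.
Proof.
move=> loc Q0; pose A := [set u | 0 <= u <= 1 /\ Q u].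
have A0 : A 0 by split=> //; rewrite lexx ler01.
have supA : has_sup A by split; [exists 0|exists 1 => u [/andP[]]].
have s0 : 0 <= sup A by apply: ub_le_sup => //; case: supA.
have s1 : sup A <= 1 by apply: ge_sup => [|u [/andP[]]] //; case: supA.
have [|del del0 locs] := loc (sup A); first by rewrite s0.
have Qs : Q (sup A).
  have [u Au usup] := sup_adherent del0 supA.
  have us : u <= sup A by apply: ub_le_sup Au; case: supA.
  case: Au => u01 Qu; apply/(locs u u01) => //.
  by rewrite ger0_norm ?subr_ge0 //; lra.
have [<-//|s1' ] := eqVneq (sup A) 1.
have lts1 : sup A < 1 by rewrite lt_neqAle s1'.
pose v := Num.min 1 (sup A + del / 2).
have sv : sup A < v by rewrite lt_min lts1 ltrDl divr_gt0.
have v01 : 0 <= v <= 1 by rewrite (le_trans s0 (ltW sv)) ge_min lexx.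
have Qv : Q v.
  apply/(locs v v01) => //; rewrite distrC ger0_norm ?subr_ge0 ?ltW //.
  have : v <= sup A + del / 2 by rewrite ge_min lexx orbT.
  by move: del0; lra.
have : v <= sup A by apply: ub_le_sup => //; case: supA.
by rewrite leNgt sv.
Qed.

(** * Roots that cannot cross the real axis *)

Section LowerHalfPlane.
Context {R : realType}.
Local Notation C := R[i].
Local Notation rc := (real_complex R).

Lemma normc_ge_Im (z : C) : rc `|complex.Im z| <= `|z|.
Proof.
by case: z => x y; rewrite normc_def /= lecR -sqrtr_sqr ler_wsqrtr // lerDr sqr_ge0.
Qed.

(** Having all roots below the axis is a locally constant property of [u]: the finitely many roots
    of a slice keep a distance [eps] from the axis, and roots of nearby slices are within [eps] of
    them and conversely. *)
Lemma roots_stay_below (h : {poly {poly C}}) d (c : C) :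
  (size h <= d.+1)%N -> h`_d = c%:P -> c != 0 ->
  (forall u x : R, 0 <= u <= 1 -> ~~ root (slice h (rc u)) (rc x)) ->
  (forall z, root (slice h 0) z -> complex.Im z < 0) ->
  forall z, root (slice h 1) z -> complex.Im z < 0.
Proof.
move=> sh hd c0 noreal low0.
pose Q (u : R) := forall z, root (slice h (rc u)) z -> complex.Im z < 0.
suff : Q 1 by rewrite /Q rmorph1.
apply: (@locally_constant_unit_interval _ Q); last by rewrite /Q rmorph0.
move=> u u01; set q := slice h (rc u).
have q0 : q != 0.
  apply: contraNneq c0 => q0.
  have := congr1 (fun q : {poly C} => q`_d) q0.
  by rewrite coef_map hd /= /horner_eval hornerC coef0 => ->.
have [eps eps0 far] : exists2 eps : R, 0 < eps &
    forall z, root q z -> eps <= `|complex.Im z|.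
  have [rs qE] := closed_field_poly_normal q.
  have Im0 z : z \in rs -> 0 < `|complex.Im z|.
    move=> zrs; rewrite normr_gt0; apply: contraNneq (noreal u (complex.Re z) u01).
    move=> Imz; rewrite -/q qE rootZ ?lead_coef_eq0 // root_prod_XsubC.
    by suff -> : rc (complex.Re z) = z by []; rewrite [RHS]complexE Imz rmorph0 mulr0 addr0.
  suff [eps eps0 far] : exists2 eps : R, 0 < eps &
      forall z, z \in rs -> eps <= `|complex.Im z|.
    exists eps => // z; rewrite qE rootZ ?lead_coef_eq0 // root_prod_XsubC.
    exact: far.
  elim: rs Im0 {qE} => [_|z rs IH Im0]; first by exists 1.
  have [|eps eps0 far] := IH; first by move=> y yrs; apply: Im0; rewrite inE yrs orbT.
  exists (Num.min eps `|complex.Im z|); first by rewrite lt_min eps0 Im0 ?mem_head.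
  move=> y; rewrite inE => /predU1P[->|/far]; first by rewrite ge_min lexx orbT.
  by rewrite ge_min => ->.
have [|del del0 near_roots] := @slice_roots_continuous _ h d c (rc eps) sh hd c0.
  by rewrite ltcR.
have delE : del = rc (complex.Re del) by rewrite RRe_real ?gtr0_real.
exists (complex.Re del) => [|v v01 uv]; first by rewrite -ltcR -delE.
have norm1 (w : R) : 0 <= w <= 1 -> `|rc w| <= 1.
  by case/andP => w0 w1; rewrite ger0_norm ?lecR.
have close : `|rc u - rc v| < del.
  by rewrite delE -rmorphB normc_def /= expr0n addr0 sqrtr_sqr ltcR.
have Im_close (y z : C) : `|y - z| < rc eps -> `|complex.Im y - complex.Im z| < eps.
  move=> /(le_lt_trans (normc_ge_Im _)); rewrite ltcR.
  by case: y z => [? ?] [? ?].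
(* In both directions [eps] keeps the roots of the slice at [u] away from the axis; such a root is
   [y] in the first case and [z] in the second. *)
split=> Qw z rz.
  have [|y ry /Im_close zy] := near_roots _ _ z (norm1 _ v01) (norm1 _ u01) _ rz.
    by rewrite distrC.
  have := Qw _ ry; have := far _ ry; move: zy.
  by rewrite ltr_norml ler_normr => /andP[? ?] /orP[] ? ?; lra.
have [y ry /Im_close zy] := near_roots _ _ z (norm1 _ u01) (norm1 _ v01) close rz.
have := Qw _ ry; have := far _ rz; move: zy.
by rewrite ltr_norml ler_normr => /andP[? ?] /orP[] ? ?; lra.
Qed.

End LowerHalfPlane.

(** * Convexity of hyperbolicity cones *)

Section Garding.
Context {R : realType} {n d : nat} (P : mpoly n R) (e : 'I_n -> R).
Local Notation C := R[i].
Local Notation rc := (real_complex R).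
Local Notation evc v := (mmap rc v P).
Local Notation evr v := (mmap idfun v P).

Context (P_homog : homog d P) (P_e : evr e != 0).
Context (P_real_rooted : forall (x : 'I_n -> R) (t : C),
  evc (fun i => rc (x i) + t * rc (e i)) = 0 -> complex.Im t = 0).

Let evcE (v : 'I_n -> R) : evc (fun i => rc (v i)) = rc (evr v).
Proof. by rewrite (rmorph_mmap idfun rc); apply: eq_mmap. Qed.

(* For [P] hyperbolic in direction [e], this is the hyperbolicity cone. *)
Definition in_cone (a : 'I_n -> R) :=
  forall t : R, 0 <= t -> evr (fun i => a i + t * e i) != 0.

Lemma in_cone_neq0 a : in_cone a -> evr a != 0.
Proof.
move=> /(_ 0 (lexx _)); congr (_ != 0).
by apply: eq_mmap => // i; rewrite mul0r addr0.
Qed.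

(** Instance of [roots_stay_below] for the path [v + u * w], with [z] moving along [a]: the leading
    coefficient in [z] is the value of [P] at [a]. *)
Lemma roots_stay_below_pencil (v w : 'I_n -> C) (a : 'I_n -> R) :
  evr a != 0 ->
  (forall u x : R, 0 <= u <= 1 ->
     evc (fun i => v i + rc u * w i + rc x * rc (a i)) != 0) ->
  (forall z, evc (fun i => v i + z * rc (a i)) = 0 -> complex.Im z < 0) ->
  forall z, evc (fun i => v i + w i + z * rc (a i)) = 0 -> complex.Im z < 0.
Proof.
move=> Pa noreal low0.
pose f : {rmorphism R -> {poly C}} := GRing.RMorphism.clone _ _ (polyC \o rc) _.
pose F : {rmorphism R -> {poly {poly C}}} := GRing.RMorphism.clone _ _ (polyC \o f) _.
(* The inner indeterminate stands for [u], the outer one for [z]. *)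
pose h := mmap F (fun i => ((v i)%:P + (w i)%:P * 'X)%:P + (f (a i))%:P * 'X) P.
have [sh hd] : (size h <= d.+1)%N /\ h`_d = mmap f (fun i => f (a i)) P.
  exact: (size_coef_mmap_line f (fun i => (v i)%:P + (w i)%:P * 'X)
    (fun i => f (a i)) P_homog).
have {}hd : h`_d = (rc (evr a))%:P.
  rewrite hd -evcE (rmorph_mmap rc polyC); exact: eq_mmap.
have hE u z : (slice h u).[z] = evc (fun i => v i + u * w i + z * rc (a i)).
  rewrite -[LHS]/(horner_eval z (map_poly (horner_eval u) h)).
  pose g : {rmorphism {poly {poly C}} -> C} :=
    GRing.RMorphism.clone _ _ (horner_eval z \o map_poly (horner_eval u)) _.
  rewrite -[LHS]/(g h) rmorph_mmap; apply: eq_mmap => [c|i] /=.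
    by rewrite map_polyC /= /horner_eval !hornerC.
  rewrite rmorphD rmorphM /= map_polyX !map_polyC /= /horner_eval.
  by rewrite !hornerE [u * _]mulrC [z * _]mulrC.
have c0 : rc (evr a) != 0 by rewrite fmorph_eq0.
move=> z; have -> : evc (fun i => v i + w i + z * rc (a i)) = (slice h 1).[z].
  by rewrite hE; apply: eq_mmap => // i; rewrite mul1r.
move=> rz; apply: (roots_stay_below sh hd c0) => [u x u01|y|]; last exact/eqP.
  by rewrite /root hE noreal.
rewrite /root hE => /eqP y0; apply: low0; rewrite -[RHS]y0.
by apply: eq_mmap => // i; rewrite mul0r addr0.
Qed.

(** By homogeneity a root [z != 0] makes [tau / z] a root of [t |-> P (a + t e)]. It is real by
    hyperbolicity and negative by [in_cone a], so the imaginary parts of [z] and [tau] have opposite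
    signs. *)
Lemma cone_root_below a tau z : in_cone a -> 0 < complex.Im tau ->
  evc (fun i => tau * rc (e i) + z * rc (a i)) = 0 -> complex.Im z < 0.
Proof.
move=> ca tau0; have [->|z0] := eqVneq z 0.
  rewrite (eq_mmap (g := rc) (w := fun i => tau * rc (e i))) => [|//|i]; last first.
    by rewrite mul0r addr0.
  rewrite (mmap_homogZ _ _ _ P_homog) evcE => /eqP.
  rewrite mulf_eq0 fmorph_eq0 (negPf P_e) orbF expf_eq0 => /andP[_ /eqP t0].
  by rewrite t0 ltxx in tau0.
rewrite (eq_mmap (g := rc) (w := fun i => z * (rc (a i) + tau / z * rc (e i))))
  => [|//|i]; last first.
  by rewrite mulrDr mulrA mulrCA divff // mulr1 addrC.
rewrite (mmap_homogZ _ _ _ P_homog) => /eqP.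
rewrite mulf_eq0 expf_eq0 (negPf z0) andbF /= => /eqP r0.
have tz := P_real_rooted r0; set t := complex.Re (tau / z).
have tzE : tau / z = rc t.
  by rewrite [LHS]complexE tz rmorph0 mulr0 addr0.
have t0 : t < 0.
  rewrite ltNge; apply/negP => /ca /negP; apply.
  apply/eqP/complexI; rewrite -evcE rmorph0 -[RHS]r0 tzE.
  by apply: eq_mmap => // i; rewrite rmorphD rmorphM.
have -> : z = rc t^-1 * tau.
  rewrite fmorphV [X in X^-1](esym tzE) invf_div divfK //.
  by apply: contraTneq tau0 => ->; rewrite ltxx.
by rewrite (_ : complex.Im _ = t^-1 * complex.Im tau) ?nmulr_rlt0 ?invr_lt0 //;
   case: (tau) => ? ? /=; rewrite mul0r addr0.
Qed.

(** Along the path from 0 to [x] no root in [z] is real: for a real root [y], [tau] would be a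
    nonreal root on the line of direction [e] through [u x + y a]. *)
Lemma cone_shifted_root_below a x tau z : in_cone a -> 0 < complex.Im tau ->
  evc (fun i => tau * rc (e i) + rc (x i) + z * rc (a i)) = 0 ->
  complex.Im z < 0.
Proof.
move=> ca tau0; apply: roots_stay_below_pencil => [|u y _|y].
- exact: in_cone_neq0.
- apply: contraTneq tau0 => r0.
  rewrite (@P_real_rooted (fun i => u * x i + y * a i) tau) ?ltxx //.
  rewrite -[RHS]r0; apply: eq_mmap => // i.
  by rewrite rmorphD !rmorphM /= addrC addrA.
- exact: cone_root_below.
Qed.

(** Deforming [s b] to 0, a real root [y] at time [u] would make [u * s] a root of the pencil in
    direction [b] with real shift [y a]. Its imaginary part would be negative by the previous
    lemma. *)
Lemma cone_pencil_root_below a b tau s z : in_cone a -> in_cone b ->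
  0 < complex.Im tau -> 0 <= complex.Im s ->
  evc (fun i => tau * rc (e i) + s * rc (b i) + z * rc (a i)) = 0 ->
  complex.Im z < 0.
Proof.
move=> ca cb tau0 s0; apply: roots_stay_below_pencil => [|u y /andP[u0 _]|y].
- exact: in_cone_neq0.
- apply/eqP => r0.
  have : complex.Im (rc u * s) < 0.
    apply: (@cone_shifted_root_below b (fun i => y * a i) tau) => //.
    rewrite -[RHS]r0; apply: eq_mmap => // i.
    by rewrite rmorphM /= addrAC mulrA.
  rewrite (_ : complex.Im _ = u * complex.Im s); last first.
    by case: (s) => ? ? /=; rewrite mul0r addr0.
  by rewrite ltNge mulr_ge0.
- exact: cone_root_below.
Qed.

Lemma cone_sum_neq0 a b t : in_cone a -> in_cone b -> 0 < t ->
  evr (fun i => a i + b i + t * e i) != 0.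
Proof.
move=> ca cb t0; apply/eqP => r0.
have : complex.Im ('i%C : C) < 0.
  (* Multiplying the zero [a + b + t e] by [i] yields the root [z = i] of the pencil with
     [tau = i t] and [s = i]. *)
  apply: (@cone_pencil_root_below a b ('i%C * rc t) 'i%C) => //=.
    by rewrite mul0r add0r mul1r.
  rewrite (eq_mmap (g := rc) (w := fun i => 'i%C * rc (a i + b i + t * e i))) => [|//|i].
    by rewrite (mmap_homogZ _ _ _ P_homog) evcE r0 rmorph0 mulr0.
  by rewrite !rmorphD rmorphM /= !mulrDr mulrA; ring.
by rewrite /= ltNge ler01.
Qed.

(** Continuity at 0 along the line. This slack is what turns the condition [0 < t] of
    [cone_sum_neq0] into [0 <= t] in [in_coneD]. *)
Lemma in_coneB a : in_cone a ->
  exists2 eta, 0 < eta & in_cone (fun i => a i - eta * e i).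
Proof.
move=> ca; pose q := mline a e P.
have qE t : q.[t] = evr (fun i => a i + t * e i) := horner_mline a e P t.
have q0 : 0 < `|q.[0]| by rewrite normr_gt0 qE ca.
have [del del0 near0] : exists2 del, 0 < del & forall t, `|t| < del -> q.[t] != 0.
  have /cvgrPdist_lt /(_ _ q0) /nbhs_ballP[del /= del0 qdel] := @continuous_horner R q 0.
  exists del => // t tdel; apply/eqP => qt.
  have := qdel t; rewrite /ball /= sub0r normrN => /(_ tdel).
  by rewrite qt subr0 ltxx.
exists (del / 2) => [|t t0]; first exact: divr_gt0.
have -> : evr (fun i => a i - del / 2 * e i + t * e i) = q.[t - del / 2].
  by rewrite qE; apply: eq_mmap => // i; ring.
have [tdel|tdel] := ltP t (del / 2); last by rewrite qE ca // subr_ge0.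
by apply: near0; rewrite ltr_norml; apply/andP; split; lra.
Qed.

Lemma in_coneD a b : in_cone a -> in_cone b -> in_cone (fun i => a i + b i).
Proof.
move=> /in_coneB[eta eta0 ca] cb t t0.
have := cone_sum_neq0 ca cb (ltr_wpDl t0 eta0); congr (_ != 0).
by apply: eq_mmap => // i; ring.
Qed.

Lemma in_coneZ a c : 0 < c -> in_cone a -> in_cone (fun i => c * a i).
Proof.
move=> c0 ca t t0.
have -> : evr (fun i => c * a i + t * e i) = evr (fun i => c * (a i + t / c * e i)).
  by apply: eq_mmap => // i; rewrite mulrDr mulrA mulrCA divff ?gt_eqF // mulr1.
rewrite (mmap_homogZ _ _ _ P_homog) mulf_neq0 ?ca ?divr_ge0 ?(ltW c0) //.
by rewrite expf_neq0 // gt_eqF.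
Qed.

End Garding.

(** * Real-rooted univariate polynomials *)

Section RealRooted.
Context {R : realType}.
Local Notation C := R[i].
Local Notation rc := (real_complex R).
Implicit Types (q : {poly R}) (rs : seq R).

Lemma real_rooted_split q : real_rooted q ->
  exists rs, q = lead_coef q *: \prod_(x <- rs) ('X - x%:P).
Proof.
move=> rq; have [->|q0] := eqVneq q 0.
  by exists [::]; rewrite lead_coef0 scale0r.
have [zs qE] := closed_field_poly_normal (map_poly rc q).
exists [seq complex.Re z | z <- zs]; apply: (map_poly_inj rc).
rewrite {1}qE map_polyZ lead_coef_map big_map rmorph_prod; congr (_ *: _).
rewrite [LHS]big_seq [RHS]big_seq; apply: eq_bigr => z zzs.
rewrite rmorphB /= map_polyX map_polyC /=; congr (_ - _%:P).
rewrite [LHS]complexE (rq z) ?rmorph0 ?mulr0 ?addr0 //.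
by rewrite qE rootZ ?root_prod_XsubC // lead_coef_map fmorph_eq0 lead_coef_eq0.
Qed.

(** The logarithmic derivative at [z] is the sum of the [1 / (z - x)], each with an imaginary part
    of sign opposite to that of [z]. *)
Lemma log_deriv_split_nonreal rs (z : C) : complex.Im z != 0 ->
  let q := \prod_(x <- rs) ('X - (rc x)%:P) in
  [/\ q.[z] != 0, complex.Im (q^`().[z] / q.[z]) * complex.Im z <= 0 &
      rs != [::] -> complex.Im (q^`().[z] / q.[z]) * complex.Im z < 0].
Proof.
move=> z0 /=; elim: rs => [|x rs [q0 le0 _]].
  by rewrite big_nil derivC horner0 hornerC oner_neq0 mul0r /= mul0r lexx.
rewrite big_cons; set q := \prod_(_ <- rs) _ in q0 le0 *.
have zx : z - rc x != 0.
  by apply: contraNneq z0 => /eqP; rewrite subr_eq0 => /eqP ->.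
rewrite derivM derivXsubC mul1r hornerD !hornerM hornerXsubC mulf_neq0 //.
have -> : (q.[z] + (z - rc x) * q^`().[z]) / ((z - rc x) * q.[z]) =
    (z - rc x)^-1 + q^`().[z] / q.[z].
  by rewrite mulrDl invfM mulrCA divff // mulr1 -invfM -mulf_div divff // mul1r.
have lt0 : complex.Im (z - rc x)^-1 * complex.Im z < 0.
  move: z0 zx; case: (z) => a b /= b0 _; rewrite subr0 mulNr oppr_lt0 mulrAC.
  by rewrite divr_gt0 ?ltr_wpDl ?sqr_ge0 // -?expr2 ?exprn_even_gt0.
have lt1 : complex.Im ((z - rc x)^-1 + q^`().[z] / q.[z]) * complex.Im z < 0.
  by rewrite raddfD mulrDl ltr_wnDr.
by rewrite ltW.
Qed.

Lemma real_rooted_neq0 q : real_rooted q -> q != 0.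
Proof.
move=> rq; apply/eqP => q0; have : complex.Im ('i%C : C) = 0.
  by apply: rq; rewrite q0 rmorph0 root0.
by move=> /eqP; rewrite /= oner_eq0.
Qed.

Let map_prod rs :
  map_poly rc (\prod_(x <- rs) ('X - x%:P)) = \prod_(x <- rs) ('X - (rc x)%:P).
Proof.
by rewrite rmorph_prod; apply: eq_bigr => x _; rewrite rmorphB /= map_polyX map_polyC.
Qed.

(** At a nonreal root, [q = s q'] would make the logarithmic derivative of [q] the real number
    [1 / s]. *)
Lemma real_rooted_subZderiv q s : real_rooted q -> real_rooted (q - s *: q^`()).
Proof.
move=> rq z; have [rs qE] := real_rooted_split rq.
have lc0 : rc (lead_coef q) != 0 by rewrite fmorph_eq0 lead_coef_eq0 real_rooted_neq0.
apply: contraTeq => z0; have [] := log_deriv_split_nonreal rs z0.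
rewrite -map_prod; set Q := map_poly rc _ => Q0 _ lt0.
have {1}-> : map_poly rc (q - s *: q^`()) = rc (lead_coef q) *: (Q - rc s *: Q^`()).
  rewrite {1 2}qE derivZ !rmorphB /= !map_polyZ /= deriv_map /= -/Q.
  by rewrite scalerBr !scalerA mulrC.
rewrite rootZ //; apply/negP => /eqP; rewrite hornerD hornerN hornerZ => /eqP.
rewrite subr_eq0 => /eqP Qs.
have [rs0|rs0] := eqVneq rs [::].
  move: Q0; rewrite Qs /Q rs0 big_nil rmorph1 derivC horner0 mulr0.
  by rewrite eqxx.
have := lt0 rs0; rewrite (_ : _ / _ = rc s^-1) /= ?mul0r ?ltxx //.
have s0 : rc s != 0 by apply: contraNneq Q0 => s0; rewrite Qs s0 mul0r.
rewrite Qs fmorphV invfM mulrCA divff ?mulr1 //.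
by apply: contraNneq Q0 => Q0; rewrite Qs Q0 mulr0.
Qed.

(** At a nonreal root of the derivative, the logarithmic derivative would vanish. The size bound
    rules out a zero derivative, of which every complex number is a root. *)
Lemma real_rooted_deriv q : (1 < size q)%N -> real_rooted q -> real_rooted q^`().
Proof.
move=> sq rq z; have [rs qE] := real_rooted_split rq.
have lc0 : lead_coef q != 0 by rewrite lead_coef_eq0 real_rooted_neq0.
apply: contraTeq => z0; have [] := log_deriv_split_nonreal rs z0.
rewrite -map_prod; set Q := map_poly rc _ => Q0 _ lt0.
rewrite {1}qE derivZ map_polyZ -deriv_map rootZ ?fmorph_eq0 // -/Q.
apply/negP => /eqP Qz.
have rs0 : rs != [::].
  by apply: contraTneq sq => rs0; rewrite qE rs0 big_nil size_scale ?size_poly1.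
by have := lt0 rs0; rewrite Qz mul0r /= mul0r ltxx.
Qed.

Lemma split_gt0 rs (t : R) : (forall x, x \in rs -> x < t) ->
  0 < (\prod_(x <- rs) ('X - x%:P)).[t].
Proof.
elim: rs => [_|x rs IH h]; first by rewrite big_nil hornerC.
rewrite big_cons hornerM hornerXsubC mulr_gt0 ?subr_gt0 ?h ?mem_head //.
by apply: IH => y yrs; apply: h; rewrite inE yrs orbT.
Qed.

Lemma split_le rs (u t : R) : (forall x, x \in rs -> x < u) -> u <= t ->
  (\prod_(x <- rs) ('X - x%:P)).[u] <= (\prod_(x <- rs) ('X - x%:P)).[t].
Proof.
move=> h ut; elim: rs h => [_|x rs IH h]; first by rewrite big_nil !hornerC.
have h' y : y \in rs -> y < u by move=> yrs; apply: h; rewrite inE yrs orbT.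
rewrite big_cons !hornerM !hornerXsubC ler_pM ?IH ?lerB //.
  by rewrite subr_ge0 ltW // h ?mem_head.
exact/ltW/split_gt0.
Qed.

Lemma split_deriv_ge0 rs (t : R) : (forall x, x \in rs -> x < t) ->
  0 <= (\prod_(x <- rs) ('X - x%:P))^`().[t].
Proof.
elim: rs => [_|x rs IH h]; first by rewrite big_nil derivC hornerC.
have h' y : y \in rs -> y < t by move=> yrs; apply: h; rewrite inE yrs orbT.
rewrite big_cons derivM derivXsubC mul1r hornerD hornerM hornerXsubC.
by rewrite addr_ge0 ?mulr_ge0 ?IH ?subr_ge0 ?ltW ?split_gt0 ?h ?mem_head.
Qed.

Lemma split_deriv_gt0 rs (t : R) : rs != [::] -> (forall x, x \in rs -> x < t) ->
  0 < (\prod_(x <- rs) ('X - x%:P))^`().[t].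
Proof.
case: rs => // x rs _ h.
have h' y : y \in rs -> y < t by move=> yrs; apply: h; rewrite inE yrs orbT.
rewrite big_cons derivM derivXsubC mul1r hornerD hornerM hornerXsubC.
by rewrite ltr_pwDl ?split_gt0 ?mulr_ge0 ?split_deriv_ge0 ?subr_ge0 ?ltW ?h ?mem_head.
Qed.

(** Away from the roots, this says that the logarithmic derivative is nonincreasing. A new factor
    [X - x] turns the gap [b ^ 2 - a c] into [a ^ 2 + y ^ 2 (b ^ 2 - a c)], with [y = t - x]. *)
Lemma split_laguerre rs (t : R) : let q := \prod_(x <- rs) ('X - x%:P) in
  q.[t] * q^`()^`().[t] <= q^`().[t] ^+ 2.
Proof.
move=> /=; elim: rs => [|x rs IH]; first by rewrite big_nil !derivC !horner0 mulr0 sqr_ge0.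
rewrite big_cons; set q := \prod_(_ <- rs) _ in IH *.
rewrite derivM derivXsubC mul1r derivD derivM derivXsubC mul1r.
rewrite !(hornerXsubC, hornerD, hornerM).
move: (q.[t]) (q^`().[t]) (q^`()^`().[t]) (t - x) IH => a b c y; rewrite -subr_ge0 => IH.
rewrite -subr_ge0 (_ : _ - _ = a ^+ 2 + y ^+ 2 * (b ^+ 2 - a * c)); last by ring.
exact: addr_ge0 (sqr_ge0 a) (mulr_ge0 (sqr_ge0 y) IH).
Qed.

Lemma nonneg_rootless_gt0 q : 0 < lead_coef q -> real_rooted q ->
  (forall t, 0 <= t -> q.[t] != 0) -> forall t, 0 <= t -> 0 < q.[t].
Proof.
move=> lc0 rq q0 t t0; have [rs qE] := real_rooted_split rq.
rewrite qE hornerZ mulr_gt0 // split_gt0 // => x xrs.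
rewrite ltNge; apply/negP => tx; have := q0 x (le_trans t0 tx).
by rewrite qE hornerZ mulf_eq0 negb_or -/(root _ _) root_prod_XsubC xrs andbF.
Qed.

Lemma nonneg_rootless_le q : 0 < lead_coef q -> real_rooted q ->
  (forall t, 0 <= t -> q.[t] != 0) -> forall t, 0 <= t -> q.[0] <= q.[t].
Proof.
move=> lc0 rq q0 t t0; have [rs qE] := real_rooted_split rq.
rewrite qE !hornerZ ler_wpM2l ?(ltW lc0) // split_le // => x xrs.
rewrite ltNge; apply/negP => tx; have := q0 x tx.
by rewrite qE hornerZ mulf_eq0 negb_or -/(root _ _) root_prod_XsubC xrs andbF.
Qed.

Lemma real_rooted_laguerre q (t : R) : real_rooted q ->
  q.[t] * q^`()^`().[t] <= q^`().[t] ^+ 2.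
Proof.
move=> /real_rooted_split[rs ->]; rewrite !derivZ !hornerZ exprMn.
rewrite mulrACA -expr2 ler_wpM2l ?sqr_ge0 //; exact: split_laguerre.
Qed.

(** By Laguerre's inequality the derivative of the quotient is nonnegative; the mean value theorem
    concludes. *)
Lemma quotient_deriv_nondecreasing q (t : R) : real_rooted q -> 0 <= t ->
  (forall u, 0 <= u -> 0 < q^`().[u]) -> q.[0] / q^`().[0] <= q.[t] / q^`().[t].
Proof.
move=> rq t0 dq0.
pose f (u : R) := q.[u] * (q^`().[u])^-1.
pose df (u : R) :=
  q.[u] * (- (q^`().[u]) ^- 2 * q^`()^`().[u]) + (q^`().[u])^-1 * q^`().[u].
have fdf (u : R) : 0 <= u -> is_derive u 1 f (df u).
  move=> u0; have qu := dq0 _ u0.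
  have V : is_derive u (1 : R) (fun x => (q^`().[x])^-1)
      (- (q^`().[u]) ^- 2 * q^`()^`().[u]).
    apply: DeriveDef; first by apply: derivableV; [rewrite gt_eqF|exact: derivable_horner].
    rewrite deriveV; [|by rewrite gt_eqF|exact: derivable_horner].
    by rewrite -derive1E -derivE.
  exact: is_derive_eq.
have [x||c cI fE] := @MVT_segment R f df 0 t t0.
- by rewrite in_itv /= => /andP[x0 _]; apply/fdf/ltW.
- apply: derivable_within_continuous => x; rewrite in_itv /= => /andP[x0 _].
  by have [] := fdf _ x0.
have c0 : 0 <= c by move: cI; rewrite in_itv /= => /andP[].
rewrite -subr_ge0 -/(f t) -/(f 0) fE mulr_ge0 ?subr_ge0 // /df.
have := real_rooted_laguerre c rq; have := dq0 _ c0.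
move: (q^`().[c]) (q.[c]) (q^`()^`().[c]) => b a a2 b0 ab.
rewrite (_ : _ + _ = (b ^+ 2 - a * a2) / b ^+ 2); last by field; rewrite gt_eqF.
by rewrite divr_ge0 ?sqr_ge0 ?subr_ge0.
Qed.

Lemma seq_max_exists rs : rs != [::] ->
  exists2 m, m \in rs & forall x, x \in rs -> x <= m.
Proof.
elim: rs => // x [|y rs] IH _.
  by exists x => [|z]; rewrite inE // => /eqP ->.
have [//|m mrs max_m] := IH.
have [xm|mx] := leP x m.
  by exists m => [|z]; rewrite inE ?mrs ?orbT // => /predU1P[->|/max_m].
exists x => [|z]; rewrite inE ?eqxx // => /predU1P[->//|/max_m zm].
by rewrite (le_trans zm) ?ltW.
Qed.

Lemma split_deriv_max_ge0 rs (m : R) : m \in rs -> (forall x, x \in rs -> x <= m) ->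
  0 <= (\prod_(x <- rs) ('X - x%:P))^`().[m].
Proof.
move=> mrs max_m; rewrite (perm_big _ (perm_to_rem mrs)) big_cons.
rewrite derivM derivXsubC mul1r hornerD hornerM hornerXsubC subrr mul0r addr0.
rewrite horner_prod big_seq; apply: prodr_ge0 => x xrs.
by rewrite hornerXsubC subr_ge0 max_m // (mem_rem xrs).
Qed.

(** Beyond the largest root [m] of [q] the derivative is positive. If [t <= m], positivity at [m]
    forces [s < 0], then [q] is nonpositive at [t], and positivity at [t] forces the derivative to
    be positive there. *)
Lemma deriv_gt0_of_subZderiv_gt0 q s (t : R) : (1 < size q)%N -> 0 < lead_coef q ->
  real_rooted q -> (forall u, 0 <= u -> 0 < (q - s *: q^`()).[u]) ->
  0 <= t -> 0 < q^`().[t].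
Proof.
move=> sq lc0 rq h0 t0; have [rs qE] := real_rooted_split rq.
have hE u : (q - s *: q^`()).[u] = q.[u] - s * q^`().[u] by rewrite !hornerE.
have rs0 : rs != [::].
  by apply: contraTneq sq => rs0; rewrite qE rs0 big_nil size_scale ?gt_eqF // size_poly1.
have [m mrs max_m] := seq_max_exists rs0.
have [mt|tm] := ltP m t.
  rewrite qE derivZ hornerZ mulr_gt0 // split_deriv_gt0 // => x /max_m xm.
  exact: le_lt_trans xm mt.
have m0 : 0 <= m := le_trans t0 tm.
have qm : q.[m] = 0.
  by apply/eqP; rewrite qE hornerZ mulf_eq0 -/(root _ _) root_prod_XsubC mrs orbT.
have dqm : 0 <= q^`().[m].
  by rewrite qE derivZ hornerZ mulr_ge0 ?split_deriv_max_ge0 // ltW.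
have s0 : s < 0.
  have := h0 _ m0; rewrite hE qm sub0r oppr_gt0 => hm.
  by rewrite ltNge; apply: contraTN hm => s0; rewrite -leNgt mulr_ge0.
(* As [s < 0], [expR (- u / s) * q u] increases, up to its zero at [m]. *)
have qt : q.[t] <= 0.
  pose f (u : R) := expR (- s^-1 * u) * q.[u].
  pose df (u : R) := - s^-1 * expR (- s^-1 * u) * (q - s *: q^`()).[u].
  have fdf (u : R) : is_derive u 1 f (df u).
    have E : is_derive u (1 : R) (fun x => expR (- s^-1 * x))
        (- s^-1 * expR (- s^-1 * u)).
      by apply: is_derive_eq; rewrite /GRing.scale /=; ring.
    apply: is_derive_eq; rewrite /df hE /GRing.scale /=; field.
    by rewrite lt_eqF.
  have [|c cI fE] := @MVT_segment R f df t m tm (fun x _ => fdf x).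
    by apply: derivable_within_continuous => x _; have [] := fdf x.
  have : 0 <= f m - f t.
    rewrite fE mulr_ge0 ?subr_ge0 // /df !mulr_ge0 ?expR_ge0 //.
      by rewrite oppr_ge0 invr_le0 ltW.
    by rewrite ltW // h0 // (le_trans t0) //; move: cI; rewrite in_itv /= => /andP[].
  by rewrite /f qm mulr0 sub0r oppr_ge0 pmulr_rle0 ?expR_gt0.
have := h0 _ t0; rewrite hE; move: (q^`().[t]) (q.[t]) qt => b a; nra.
Qed.

(** From left to right, the leading coefficient is that of [q], so having no root on [[0, +oo[]
    means being positive there. From right to left, [s] stays below [q / q'], which does not fall
    below its value at 0. *)
Lemma subZderiv_rootless q s : (1 < size q)%N -> 0 < lead_coef q -> real_rooted q ->
  (forall t, 0 <= t -> (q - s *: q^`()).[t] != 0) <->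
  (forall t, 0 <= t -> 0 < q^`().[t]) /\ s < q.[0] / q^`().[0].
Proof.
move=> sq lc0 rq; have hE u : (q - s *: q^`()).[u] = q.[u] - s * q^`().[u].
  by rewrite !hornerE.
split=> [h0|[dq0 sq0] t t0].
  have lc : lead_coef (q - s *: q^`()) = lead_coef q.
    rewrite lead_coefDl // size_polyN (leq_ltn_trans (size_scale_leq _ _)) //.
    by rewrite lt_size_deriv // real_rooted_neq0.
  have {}h0 t : 0 <= t -> 0 < (q - s *: q^`()).[t].
    by apply: nonneg_rootless_gt0 => //; [rewrite lc|exact: real_rooted_subZderiv].
  have dq0 t : 0 <= t -> 0 < q^`().[t].
    exact: (@deriv_gt0_of_subZderiv_gt0 q s).
  by split=> //; rewrite ltr_pdivlMr ?dq0 // -subr_gt0 -hE h0.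
rewrite hE gt_eqF // subr_gt0 -ltr_pdivlMr ?dq0 //.
exact: lt_le_trans sq0 (quotient_deriv_nondecreasing rq t0 dq0).
Qed.

End RealRooted.

(** * Polynomial functions on a Euclidean space *)

Section EuclideanContinuity.
Context {R : realType} {E : euclideanType R}.
Local Notation n := (\dim {: E}).
Local Notation b := (vbasis {: E}).

Lemma dotpC (x y : E) : dotp x y = dotp y x.
Proof. by rewrite [LHS]hermC expr0 mul1r. Qed.

Lemma dotpD (x y z : E) : dotp x (y + z) = dotp x y + dotp x z.
Proof. exact: linearDr. Qed.

Lemma dotpZr (x y : E) a : dotp x (a *: y) = a * dotp x y.
Proof. exact: linearZr_LR. Qed.

Lemma dotp_sumr (I : Type) (r : seq I) (x : E) (F : I -> E) :
  dotp x (\sum_(i <- r) F i) = \sum_(i <- r) dotp x (F i).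
Proof. by rewrite linear_sumr. Qed.

(** Obtained by squaring the triangle inequality of the norm and expanding. *)
Lemma dotp_cauchy_schwarz (x y : E) : `|dotp x y| <= `|x| * `|y|.
Proof.
have le (u v : E) : dotp u v <= `|u| * `|v|.
  have sq2 : `|u + v| ^+ 2 = `|u| ^+ 2 + `|v| ^+ 2 + dotp u v *+ 2.
    by rewrite !sqr_norm_dotp hnormD expr0 mul1r /= mulr2n.
  have : `|u + v| ^+ 2 <= (`|u| + `|v|) ^+ 2.
    by rewrite lerXn2r ?nnegrE ?addr_ge0 // ler_normD.
  rewrite sq2 sqrrD; lra.
rewrite ler_norml le andbT lerNl -linearNl.
by rewrite (le_trans (le _ _)) // normrN.
Qed.

(** In the basis [b], the matrix of this map is the Gram matrix of [b]. *)
Let gram (v : E) : E := \sum_(i < n) dotp v b`_i *: b`_i.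

Let gram_linear : linear gram.
Proof.
move=> a u v; rewrite /gram scaler_sumr -big_split /=; apply: eq_bigr => i _.
by rewrite dotpC dotpD dotpZr ![dotp b`_i _]dotpC scalerDl scalerA.
Qed.

HB.instance Definition _ := GRing.isLinear.Build R E E _ gram gram_linear.

(** The map [gram] is injective, a vector orthogonal to the basis having norm 0. Hence some [v] has
    prescribed products with the basis vectors. *)
Lemma riesz (f : {linear E -> R}) : exists v, forall x, f x = dotp x v.
Proof.
have bfree : free b := basis_free (vbasisP _).
have ker0 : lker (linfun gram) == 0%VS.
  rewrite -subv0; apply/subvP => v; rewrite memv_ker lfunE /= memv0 => /eqP gv.
  have vb (i : 'I_n) : dotp v b`_i = 0.
    have := congr1 (coord b i) gv; rewrite linear0 coord_sum_free //.
  have : `|v| ^+ 2 = 0.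
    rewrite sqr_norm_dotp {2}(coord_vbasis (memvf v)) dotp_sumr big1 // => i _.
    by rewrite dotpZr vb mulr0.
  by move/eqP; rewrite sqrf_eq0 normr_eq0.
pose w := \sum_(i < n) f b`_i *: b`_i.
pose v := ((linfun gram)^-1)%VF w.
have gv : gram v = w by rewrite -[LHS]lfunE lker0_lfunVK.
exists v => x; rewrite dotpC (coord_vbasis (memvf x)).
rewrite linear_sum dotp_sumr; apply: eq_bigr => i _.
rewrite linearZ dotpZr /=; congr (_ * _).
have := congr1 (coord b i) gv; rewrite !coord_sum_free // => ->.
Qed.

(** Riesz and Cauchy-Schwarz bound [f]. Coordinates, and then polynomials, are thereby
    differentiable. *)
Lemma linear_functional_continuous (f : {linear E -> R}) : continuous f.
Proof.
have [v fE] := riesz f.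
apply/linear_bounded_continuous/linear_boundedP; near=> r => x.
apply: (le_trans (_ : _ <= `|x| * `|v|)); first by rewrite fE dotp_cauchy_schwarz.
rewrite mulrC; apply: ler_wpM2r; first exact: normr_ge0.
by near: r; apply: nbhs_pinfty_ge; rewrite num_real.
Unshelve. all: by end_near. Qed.

Definition coords (x : E) (i : 'I_n) : R := coord b i x.

Lemma meval_coords_differentiable (Q : mpoly n R) (x : E) :
  differentiable (fun x => meval (coords x) Q) x.
Proof.
elim/(@mpoly_ring_ind n R): Q => [c|i|Q1 Q2 IH1 IH2|Q1 Q2 IH1 IH2].
- rewrite (_ : (fun _ => _) = cst c); first exact: differentiable_cst.
  by apply/funext => y; rewrite mevalC.
- rewrite (_ : (fun _ => _) = coord b i); last by apply/funext => y; rewrite mevalXU.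
  apply/linear_differentiable/linear_functional_continuous.
- rewrite (_ : (fun _ => _) =
    (fun x => meval (coords x) Q1) + (fun x => meval (coords x) Q2)).
    exact: differentiableD.
  by apply/funext => y; rewrite mevalD.
- rewrite (_ : (fun _ => _) =
    (fun x => meval (coords x) Q1) * (fun x => meval (coords x) Q2)).
    exact: differentiableM.
  by apply/funext => y; rewrite mevalM.
Qed.

Lemma meval_coords_continuous (Q : mpoly n R) :
  continuous (fun x : E => meval (coords x) Q).
Proof. by move=> x; apply/differentiable_continuous/meval_coords_differentiable. Qed.

Lemma coordsD x y i : coords (x + y) i = coords x i + coords y i.
Proof. exact: linearD. Qed.

Lemma coordsZ c x i : coords (c *: x) i = c * coords x i.
Proof. exact: linearZ. Qed.

Lemma coords_surj (v : 'I_n -> R) : exists x, coords x =1 v.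
Proof.
exists (\sum_(i < n) v i *: b`_i) => i; rewrite /coords.
by rewrite coord_sum_free // (basis_free (vbasisP _)).
Qed.

(** Both sides are the derivative at 0 of the restriction of [Q] to the line through [x] in
    direction [e]. *)
Lemma dir_deriv_meval (Q : mpoly n R) (e x : E) :
  dir_deriv (fun x => meval (coords x) Q) e x =
  meval (coords x) (mdirderiv (coords e) Q).
Proof.
rewrite /dir_deriv -deriveE; last exact: meval_coords_differentiable.
pose q := mline (coords x) (coords e) Q.
have -> : 'D_e (fun x => meval (coords x) Q) x = 'D_1 (horner q) 0.
  rewrite /derive; congr (lim (_ @ 0^')). apply/funext => h /=.
  rewrite !horner_mline; congr (_ *: (_ - _)).
    apply: eq_mmap => // i.
    by rewrite coordsD coordsZ addr0 [h *: 1]mulr1 addrC.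
  by apply: eq_mmap => // i; rewrite mul0r addr0.
rewrite -derive1E -derivE deriv_mline horner_mline.
by apply: eq_mmap => // i; rewrite mul0r addr0.
Qed.

End EuclideanContinuity.

(** * The hypograph as a hyperbolicity cone *)

Section HypographPolynomial.
Context {n : nat} {A : comNzRingType}.
Implicit Types (P : mpoly n A) (v e : 'I_n -> A) (s : A).

Definition extend v s (i : 'I_n.+1) : A :=
  if unlift ord_max i is Some j then v j else s.

Lemma extend_max v s : extend v s ord_max = s.
Proof. by rewrite /extend unlift_none. Qed.

Lemma extend_widen v s i : extend v s (widen_ord (leqnSn n) i) = v i.
Proof.
rewrite /extend (_ : widen_ord _ i = lift ord_max i) ?liftK //.
by apply: val_inj; rewrite /= /bump leqNgt ltn_ord.
Qed.

Lemma extendE (w : 'I_n.+1 -> A) :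
  w = extend (fun i => w (widen_ord (leqnSn n) i)) (w ord_max).
Proof.
apply/funext => i; rewrite /extend; case: unliftP => [j ->|-> //].
by congr w; apply: val_inj; rewrite /= /bump leqNgt ltn_ord.
Qed.

(** The last variable stands for [s]. *)
Definition hypograph_poly e P : mpoly n.+1 A :=
  mwiden P - mpolyX A (mnm1 ord_max) * mwiden (mdirderiv e P).

Lemma hypograph_poly_homog d e P : homog d.+1 P -> homog d.+1 (hypograph_poly e P).
Proof.
move=> hP; apply: rpredB; first exact: mwiden_homog.
rewrite -[d.+1]add1n; apply: dhomogM.
  by rewrite dhomogX /= mdeg1.
exact/mwiden_homog/(mdirderiv_homog e hP).
Qed.

Lemma mmap_hypograph_poly (S : comNzRingType) (f : {rmorphism A -> S})
    v s e P t :
  mmap f (fun i => f (extend v s i) + t * f (extend e 0 i)) (hypograph_poly e P) =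
  (map_poly f (mline v e P - s *: (mline v e P)^`())).[t].
Proof.
rewrite [in RHS]rmorphB /= map_polyZ deriv_mline hornerD hornerN hornerZ !horner_map_mline.
rewrite /hypograph_poly rmorphB rmorphM /= mmapX mmap1U !mmap_mwiden.
rewrite !extend_max rmorph0 mulr0 addr0; congr (_ - _ * _).
  by apply: eq_mmap => // i; rewrite !extend_widen.
by apply: eq_mmap => // i; rewrite !extend_widen.
Qed.

End HypographPolynomial.

(** * Concavity of the quotient on the derivative cone *)

Section DerivativeCone.
Context {R : realType} {E : euclideanType R} (p : E -> R) (e : E).
Context (d : nat) (P : mpoly (\dim {: E}) R).
Context (P_homog : homog d.+1 P) (pE : forall x, p x = meval (coords x) P).
Context (p_e : 0 < p e).
Context (p_real_rooted : forall x, exists q : {poly R},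
  (forall t : R, q.[t] = p (x + t *: e)) /\ real_rooted q).

Let dp (x : E) : R := meval (coords x) (mdirderiv (coords e) P).
Let line (x : E) : {poly R} := mline (coords x) (coords e) P.

Lemma lineE x t : (line x).[t] = p (x + t *: e).
Proof.
rewrite horner_mline pE; apply: eq_mmap => // i.
by rewrite coordsD coordsZ.
Qed.

Lemma deriv_lineE x t : (line x)^`().[t] = dp (x + t *: e).
Proof.
rewrite deriv_mline horner_mline; apply: eq_mmap => // i.
by rewrite coordsD coordsZ.
Qed.

Lemma line_real_rooted x : real_rooted (line x).
Proof.
have [q [qE rq]] := p_real_rooted x.
by rewrite (_ : line x = q) //; apply: horner_inj => t; rewrite lineE qE.
Qed.

Lemma size_line x : size (line x) = d.+2 /\ lead_coef (line x) = p e.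
Proof.
have [] := size_coef_mmap_line idfun (coords x) (coords e) P_homog.
rewrite -[mmap _ _ _]/(line x) -[RHS in _ = RHS]/(meval (coords e) P) -pE => sl cl.
have sl' : size (line x) = d.+2.
  by apply: size_poly_coef_neq0 sl _; rewrite cl gt_eqF.
by rewrite lead_coefE sl' cl.
Qed.

Let quotient_line x : (line x).[0] / (line x)^`().[0] = p x / dp x.
Proof. by rewrite lineE deriv_lineE scale0r addr0. Qed.

(** A description along rays, which matches [in_cone]; [hyp_cone_derivative] identifies this set
    with the connected component. *)
Definition derivative_cone := [set x : E | forall t : R, 0 <= t -> 0 < dp (x + t *: e)].

Let F := hypograph_poly (coords e) P.
Let in_hypograph x s := in_cone F (extend (coords e) 0) (extend (coords x) s).

Let evF x s t :
  mmap idfun (fun i => extend (coords x) s i + t * extend (coords e) 0 i) F =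
  (line x - s *: (line x)^`()).[t].
Proof. by rewrite (mmap_hypograph_poly idfun) map_poly_id. Qed.

Lemma in_hypographP x s : in_hypograph x s <-> derivative_cone x /\ s < p x / dp x.
Proof.
have [sl ll] := size_line x.
have := @subZderiv_rootless _ (line x) s; rewrite sl ll quotient_line.
move=> /(_ isT p_e (@line_real_rooted x)) h.
split=> [Fx|[dl sq] t t0].
  have /h[dl sq] : forall t, 0 <= t -> (line x - s *: (line x)^`()).[t] != 0.
    by move=> t /Fx; rewrite evF.
  by split=> // t t0; rewrite -deriv_lineE dl.
rewrite evF; move: t t0; apply/h; split=> // t t0.
by rewrite deriv_lineE dl.
Qed.

Let F_homog : homog d.+1 F := hypograph_poly_homog (coords e) P_homog.

Let F_e : mmap idfun (extend (coords e) 0) F != 0.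
Proof.
suff -> : mmap idfun (extend (coords e) 0) F = p e by rewrite gt_eqF.
have := evF 0 0 1; rewrite scale0r subr0 lineE add0r scale1r => <-.
apply: eq_mmap => // i; rewrite mul1r -[LHS]add0r; congr (_ + _).
by rewrite /extend; case: unliftP => // j _; rewrite /coords linear0.
Qed.

Let F_real_rooted (w : 'I_(\dim {: E}).+1 -> R) (t : R[i]) :
  mmap (real_complex R)
    (fun i => real_complex R (w i) + t * real_complex R (extend (coords e) 0 i))
    F = 0 ->
  complex.Im t = 0.
Proof.
rewrite (extendE w).
have [x /funext <-] := coords_surj (fun i => w (widen_ord (leqnSn _) i)).
rewrite mmap_hypograph_poly => /eqP.
exact/real_rooted_subZderiv/line_real_rooted.
Qed.

Let in_hypographD x y s u :
  in_hypograph x s -> in_hypograph y u -> in_hypograph (x + y) (s + u).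
Proof.
move=> hx hy; have := in_coneD F_homog F_e F_real_rooted hx hy.
congr in_cone; apply/funext => i; rewrite /extend; case: unliftP => // j _.
by rewrite coordsD.
Qed.

Let in_hypographZ x s c : 0 < c -> in_hypograph x s -> in_hypograph (c *: x) (c * s).
Proof.
move=> c0 hx; have := in_coneZ F_homog c0 hx.
congr in_cone; apply/funext => i; rewrite /extend; case: unliftP => // j _.
by rewrite coordsZ.
Qed.

Let in_hypographB x s : in_hypograph x s ->
  exists2 eta, 0 < eta & in_hypograph (x - eta *: e) s.
Proof.
move=> /in_coneB[eta eta0 hx]; exists eta => //; move: hx.
congr in_cone; apply/funext => i; rewrite /extend; case: unliftP => [j _|_].
  by rewrite coordsD -(scaleNr eta e) coordsZ mulNr.
by rewrite mulr0 subr0.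
Qed.

(** Every point of the cone lifts to the hypograph, so closure properties proved there project to
    [derivative_cone]. *)
Let in_hypograph_cone x : derivative_cone x -> in_hypograph x (p x / dp x - 1).
Proof. by move=> cx; apply/in_hypographP; split=> //; rewrite ltrBlDr ltrDl. Qed.

Lemma derivative_coneD x y :
  derivative_cone x -> derivative_cone y -> derivative_cone (x + y).
Proof.
move=> /in_hypograph_cone hx /in_hypograph_cone hy.
by have /in_hypographP[] := in_hypographD hx hy.
Qed.

Lemma derivative_coneZ c x : 0 < c -> derivative_cone x -> derivative_cone (c *: x).
Proof.
move=> c0 /in_hypograph_cone hx.
by have /in_hypographP[] := in_hypographZ c0 hx.
Qed.

Lemma derivative_coneB x : derivative_cone x ->
  exists2 eta, 0 < eta & derivative_cone (x - eta *: e).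
Proof.
move=> /in_hypograph_cone/in_hypographB[eta eta0 /in_hypographP[cx _]].
by exists eta.
Qed.

Lemma quotient_concave x y a b : derivative_cone x -> derivative_cone y ->
  0 < a -> 0 < b -> a + b = 1 ->
  a * (p x / dp x) + b * (p y / dp y) <=
  p (a *: x + b *: y) / dp (a *: x + b *: y).
Proof.
move=> cx cy a0 b0 ab; set q := p _ / dp (a *: x + b *: y).
rewrite leNgt; apply/negP => ltq.
(* Both points are lowered by the supposed defect [del]. Their combination then has last coordinate
   exactly [q], which the strict hypograph excludes. *)
pose del := a * (p x / dp x) + b * (p y / dp y) - q.
have del0 : 0 < del by rewrite subr_gt0.
have hx : in_hypograph x (p x / dp x - del).
  by apply/in_hypographP; split=> //; rewrite ltrBlDr ltrDl.
have hy : in_hypograph y (p y / dp y - del).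
  by apply/in_hypographP; split=> //; rewrite ltrBlDr ltrDl.
have /in_hypographP[_] := in_hypographD (in_hypographZ a0 hx) (in_hypographZ b0 hy).
rewrite -/q; set lhs := (X in X < _).
suff -> : lhs = q by rewrite ltxx.
rewrite {}/lhs.
transitivity (a * (p x / dp x) + b * (p y / dp y) - (a + b) * del); first by ring.
by rewrite ab /del; ring.
Qed.

(** * The derivative cone as a connected component *)

Let dp_homog x c : dp (c *: x) = c ^+ d * dp x.
Proof.
rewrite -(mmap_homogZ _ _ _ (mdirderiv_homog (coords e) P_homog)).
by apply: eq_mmap => // i; rewrite coordsZ.
Qed.

Let dp_continuous : continuous dp.
Proof. exact: meval_coords_continuous. Qed.

Let p_homog x c : p (c *: x) = c ^+ d.+1 * p x.
Proof.
rewrite !pE -(mmap_homogZ _ _ _ P_homog).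
by apply: eq_mmap => // i; rewrite coordsZ.
Qed.

(** The case [s = 0] of [subZderiv_rootless]: by homogeneity [p] equals [(1 + t) ^ d.+1 * p e] along
    the ray from [e]. *)
Lemma derivative_cone_dir : derivative_cone e.
Proof.
have [sl ll] := size_line e.
have := @subZderiv_rootless _ (line e) 0; rewrite sl ll.
move=> /(_ isT p_e (@line_real_rooted e))[h _].
have [t t0|dl _ t t0] := h; last by rewrite -deriv_lineE dl.
rewrite scale0r subr0 lineE -{1}[e]scale1r -scalerDl p_homog mulf_neq0 ?gt_eqF //.
by rewrite exprn_gt0 // ltr_wpDr.
Qed.

Lemma derivative_cone_gt0 x : derivative_cone x -> 0 < dp x.
Proof. by move=> /(_ 0 (lexx _)); rewrite scale0r addr0. Qed.

(** Dividing [y + t e] by [1 + t] gives a point at least as close to [e] as [y], so a ball where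
    [dp] is positive serves for all [t] at once. *)
Lemma derivative_cone_nbhs_dir :
  exists2 r, 0 < r & forall y, `|e - y| < r -> derivative_cone y.
Proof.
have dpe := derivative_cone_gt0 derivative_cone_dir.
have /nbhs_normP[r /= r0 near_e] : \near e, 0 < dp e.
  have /cvgr_gt := @dp_continuous e; exact.
exists r => // y ye t t0; have t1 : 0 < 1 + t by rewrite ltr_pwDl.
have -> : y + t *: e = (1 + t) *: (e - (1 + t)^-1 *: (e - y)).
  rewrite scalerBr scalerA divff ?gt_eqF // scalerDl scale1r scale1r.
  by rewrite opprB [RHS]addrC addrA subrK.
rewrite dp_homog mulr_gt0 ?exprn_gt0 //; apply: near_e => /=.
rewrite opprB addrC subrK normrZ gtr0_norm ?invr_gt0 //.
by rewrite (le_lt_trans _ ye) // ler_piMl // invf_le1 // lerDl.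
Qed.

(** A point near [x] is [x - eta e], still in the cone, plus [eta] times a point near [e]. *)
Lemma derivative_cone_open : open derivative_cone.
Proof.
rewrite openE => x cx; have [eta eta0 cx'] := derivative_coneB cx.
have [r r0 near_e] := derivative_cone_nbhs_dir.
apply/nbhs_normP; exists (eta * r); first exact: mulr_gt0.
move=> y /= xy; have -> : y = x - eta *: e + eta *: (e - eta^-1 *: (x - y)).
  rewrite scalerBr scalerA divff ?gt_eqF // scale1r addrA subrK.
  by rewrite opprB [RHS]addrC subrK.
apply: derivative_coneD => //; apply: derivative_coneZ => //; apply: near_e.
rewrite opprB addrC subrK normrZ gtr0_norm ?invr_gt0 //.
by rewrite mulrC ltr_pdivrMr // mulrC.
Qed.

Lemma derivative_cone_le x t : derivative_cone x -> 0 <= t -> dp x <= dp (x + t *: e).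
Proof.
move=> cx t0; have [sl ll] := size_line x.
have sl1 : (1 < size (line x))%N by rewrite sl.
have := nonneg_rootless_le _ (real_rooted_deriv sl1 (@line_real_rooted x)).
move=> /(_ _ _ _ t0); rewrite !deriv_lineE scale0r addr0; apply.
  have cd : (line x)^`()`_d = p e *+ d.+1 by rewrite coef_deriv -ll lead_coefE sl.
  have pd : 0 < p e *+ d.+1 by rewrite pmulrn_lgt0.
  suff -> : lead_coef (line x)^`() = p e *+ d.+1 by [].
  rewrite lead_coefE (@size_poly_coef_neq0 _ _ d) ?cd ?gt_eqF //.
  by rewrite -ltnS -sl lt_size_deriv // real_rooted_neq0 //; exact: line_real_rooted.
by move=> u u0; rewrite deriv_lineE gt_eqF // cx.
Qed.

(** [derivative_cone] meets the component in a nonempty, relatively open and closed set, hence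
    contains it. Conversely, each of its points is joined to [e] by a segment on which [dp] is
    positive. *)
Lemma hyp_cone_derivative : hyp_cone dp e = derivative_cone.
Proof.
have ce := derivative_cone_dir; have dpe := derivative_cone_gt0 ce.
apply/seteqP; split => x.
  suff <- : hyp_cone dp e `&` derivative_cone = hyp_cone dp e by case.
  apply: (@component_connected E [set x | 0 < dp x] e).
  - by exists e; split=> //; exact: connected_component_refl.
  - by exists derivative_cone => //; exact: derivative_cone_open.
  (* On the component, [derivative_cone] is cut out by the closed conditions
     [dp y <= dp (y + t *: e)]: a polynomial with only negative roots increases. *)
  exists (\bigcap_(t in [set t : R | 0 <= t])
    (fun y => dp (y + t *: e) - dp y) @^-1` [set s | 0 <= s]).
    apply: closed_bigI => t _; apply: closed_comp; last exact: closed_ge.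
    move=> y _; apply: cvgB; last exact: dp_continuous.
    apply: (@continuous_comp _ _ _ (fun y => y + t *: e) dp); last exact: dp_continuous.
    by apply: cvgD; [exact: cvg_id|exact: cvg_cst].
  apply/seteqP; split=> y [Ky cy]; split=> // t t0 /=.
    by rewrite subr_ge0 derivative_cone_le.
  have /= := cy t t0; rewrite subr_ge0; apply: lt_le_trans.
  exact: (connected_component_sub Ky).
move=> cx; pose seg (u : R) := x + u *: (e - x).
suff : [set seg u | u in `[0, 1]] `<=` hyp_cone dp e.
  by apply; exists 0; [rewrite /= in_itv /= lexx ler01|rewrite /seg scale0r addr0].
apply: connected_component_max.
- by exists 1; [rewrite /= in_itv /= lexx ler01|rewrite /seg scale1r addrC subrK].
- move=> _ [u /= + <-]; rewrite in_itv /= => /andP[u0].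
  rewrite le_eqVlt => /predU1P[->|u1].
    by rewrite /seg scale1r addrC subrK.
  have u1' : 0 < 1 - u by rewrite subr_gt0.
  (* Up to a positive factor, a point of the segment with [u < 1] lies on the ray from [x] in
     direction [e]. *)
  have -> : seg u = (1 - u) *: (x + (u / (1 - u)) *: e).
    rewrite scalerDr scalerA mulrCA divff ?gt_eqF // mulr1 scalerBl scale1r.
    by rewrite /seg scalerBr addrA addrAC.
  by rewrite dp_homog mulr_gt0 ?exprn_gt0 // cx // divr_ge0 // ltW.
- apply: connected_continuous_connected; first exact: segment_connected.
  apply: continuous_subspaceT => u; apply: cvgD; first exact: cvg_cst.
  by apply: cvgZr_tmp; exact: cvg_id.
Qed.

End DerivativeCone.

Theorem theorem7 (R : realType) (E : euclideanType R) (p : E -> R) (e : E)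
    (p_nonconstant : ~ exists c : R, forall x : E, p x = c)
    (p_hyperbolic : hyperbolic p e) :
  concave_function (hyp_cone (dir_deriv p e) e)
    (fun x : E => p x / dir_deriv p e x).
Proof.
case: p_hyperbolic => -[d [P [P_homog pE]]] p_e p_rr.
(* In degree 0, scaling [x] by 0 and [0 ^+ 0 = 1] give [p x = p 0]. *)
case: d P_homog => [P_homog|d P_homog].
  case: p_nonconstant; exists (p 0) => x.
  have := mmap_homogZ idfun 0 (coords x) P_homog; rewrite expr0 mul1r => p0.
  rewrite !pE -[LHS]p0; apply: eq_mmap => // i.
  by rewrite mul0r linear0.
pose dp (x : E) := meval (coords x) (mdirderiv (coords e) P).
have -> : dir_deriv p e = dp.
  have /funext -> : p =1 (fun x => meval (coords x) P) by exact: pE.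
  by apply/funext => x; exact: dir_deriv_meval.
rewrite (hyp_cone_derivative P_homog pE p_e p_rr).
split.
  apply/convex_setW => x y /set_mem cx /set_mem cy k k0 k1.
  apply/mem_set/(derivative_coneD P_homog pE p_e p_rr).
    exact: (derivative_coneZ P_homog pE p_e p_rr k0 cx).
  have k1' : 0 < 1 - k%:num by rewrite subr_gt0.
  exact: (derivative_coneZ P_homog pE p_e p_rr k1' cy).
move=> t x y /set_mem cx /set_mem cy.
(* At the endpoints both sides coincide; [quotient_concave] takes positive weights. *)
have [->|t0] := eqVneq t 0%:i01; first by rewrite !conv0.
have [->|t1] := eqVneq t 1%:i01; first by rewrite !conv1.
have t0' : 0 < t%:num by rewrite lt_neqAle eq_sym t0 ge0.
have t1' : 0 < 1 - t%:num by rewrite subr_gt0 lt_neqAle t1 le1.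
apply: (quotient_concave P_homog pE p_e p_rr cx cy t0' t1').
by rewrite addrC subrK.
Qed.
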